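(* For every $\epsilon \geq 16/m$ and $m \geq 4$, $$\mathbf{E}\left| \max_{f \in \mathrm{conv}(\Psi),\ \|f\|_n \leq \epsilon} \frac{1}{n} \sum_{i=1}^n f(x_i)\varepsilon_i \right| \leq 20\sqrt{1+2A}\,\epsilon^s \sqrt{\frac{\log(6m)}{n}} .$$
   Context: Let $x_1,\ldots,x_n$ be fixed (non-random) points of a set $\mathcal{X}$, and let $\psi_1,\ldots,\psi_m:\mathcal{X}\to\mathbf{R}$ be given functions; $\Psi:=\{\psi_k\}_{k=1}^m$. For a function $f$ on $\mathcal{X}$ put $\|f\|_n:=\left(\frac1n\sum_{i=1}^n f(x_i)^2\right)^{1/2}$ and $\|f\|_\infty:=\max_{1\le i\le n}|f(x_i)|$. $\mathrm{conv}(\Psi):=\{\sum_{k=1}^m\theta_k\psi_k:\ \theta_k\ge 0,\ \sum_{k=1}^m\theta_k=1\}$ is the convex hull of $\Psi$. Standing assumptions: Assumption A: $\|\psi_k\|_\infty\le 1$ for $1\le k\le m$. Assumption B: for some constants $A\ge 1$ and $0<s\le 1$, with $V:=2/s-2$, it holds that $N(\epsilon,\Psi)\le A\epsilon^{-V}$ for all $0<\epsilon\le 1$, where $N(\epsilon,\Psi)$ is the $\epsilon$-covering number of $(\Psi,\|\cdot\|_n)$, i.e. the minimal number of closed $\|\cdot\|_n$-balls of radius $\epsilon$ needed to cover $\Psi$. $\varepsilon_1,\ldots,\varepsilon_n$ is a Rademacher sequence: i.i.d. random variables taking the values $\pm1$ with probability $1/2$ each. A maximum over an empty set is read as $0$.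 *)

(* Defs.v *)
From HB Require Import structures.
From mathcomp Require Import all_boot all_order all_algebra.
From mathcomp Require Import all_classical all_reals all_analysis.

Set Implicit Arguments.
Unset Strict Implicit.
Unset Printing Implicit Defensive.

Import Order.TTheory GRing.Theory Num.Theory.
Import numFieldNormedType.Exports.

Local Open Scope classical_set_scope.
Local Open Scope ring_scope.

Section EmpiricalNorms.
Context {R : realType} {X : Type} {n : nat} (x : 'I_n -> X).

Definition norm_n (f : X -> R) : R :=
  Num.sqrt (n%:R^-1 * \sum_(i < n) f (x i) ^+ 2).

Definition norm_inf (f : X -> R) : R :=
  \big[Num.max/0]_(i < n) `|f (x i)|.

Definition closed_ball_n (c : X -> R) (e : R) : set (X -> R) :=
  [set f | norm_n (f \- c) <= e].

(* The centers are arbitrary functions: they need not belong to [Psi].  The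
   value is [+oo] when finitely many balls do not suffice, and otherwise the
   infimum is attained, being that of a nonempty set of natural numbers. *)
Definition covering_number (e : R) (Psi : set (X -> R)) : \bar R :=
  ereal_inf [set (N%:R : R)%:E | N in
    [set N : nat | exists c : 'I_N -> X -> R,
      Psi `<=` \bigcup_j closed_ball_n (c j) e]].

End EmpiricalNorms.

Definition conv_hull {R : realType} {X : Type} {m : nat}
    (psi : 'I_m -> X -> R) : set (X -> R) :=
  [set f | exists theta : 'I_m -> R,
    [/\ forall k, 0 <= theta k, \sum_(k < m) theta k = 1
      & f = (fun y => \sum_(k < m) theta k * psi k y)]].

Section Rademacher.
Context {R : realType} {d : measure_display} {T : measurableType d}.
Context (P : probability T R) {n : nat}.

Definition mutually_independent (X : 'I_n -> {RV P >-> R}) : Prop :=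
  forall (J : {set 'I_n}) (B : 'I_n -> set R),
    (forall i, measurable (B i)) ->
    P (\bigcap_(i in [set i | i \in J]) (X i @^-1` B i)) =
    (\prod_(i in J) P (X i @^-1` B i))%E.

Definition rademacher_sequence (eps : 'I_n -> {RV P >-> R}) : Prop :=
  mutually_independent eps /\
  forall i, P (eps i @^-1` [set 1]) = (2^-1 : R)%:E /\
            P (eps i @^-1` [set -1]) = (2^-1 : R)%:E.

End Rademacher.

(* The maximum of n^-1 * \sum_i f (x i) * sigma i over the f in the convex hull
   with norm_n f <= e.  The values (f (x i))_i of these f form a compact set, so
   the supremum is a maximum whenever there is such an f; when there is none,
   [sup set0 = 0] is the convention for an empty maximum. *)
Definition conv_max {R : realType} {X : Type} {n m : nat} (x : 'I_n -> X)
    (psi : 'I_m -> X -> R) (e : R) (sigma : 'I_n -> R) : R :=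
  sup [set n%:R^-1 * \sum_(i < n) f (x i) * sigma i | f in
        [set f | conv_hull psi f /\ norm_n x f <= e]].

(* Main.v *)
Require Import Defs.
From HB Require Import structures.
From mathcomp Require Import all_boot all_order all_algebra.
From mathcomp Require Import all_classical all_reals all_analysis.
From mathcomp Require Import measurable_realfun ring lra.
Import Order.TTheory GRing.Theory Num.Theory.
Import numFieldNormedType.Exports.
Local Open Scope classical_set_scope.
Local Open Scope ring_scope.

(** Put [r = min e 1] and [delta = r `^ s]; on the convex hull, whose members
have empirical norm at most 1, the constraints [norm_n f <= e] and
[norm_n f <= r] agree.  Identify a function with the row of its values at the
design points.  By the covering assumption at scale [delta], [Psi] is within
[delta] of [N <= A * r `^ (2 * s - 2)] centers.  Let [P] be the orthogonal
projector onto the span of the centers and split [f] as [f P + f (1 - P)].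

- [f P] has norm at most [r] and lives in a space of dimension at most [N], so
  its correlation with the signs [sg] is at most [|f| |sg P|], and the mean of
  [|sg P|^2] is the trace of [P].  This costs [r * sqrt (N / n)], which is at
  most [sqrt A * delta / sqrt n].
- [f (1 - P)] is the convex combination, with the weights of [f], of the
  [psi_k (1 - P)].  These have norm at most [delta], since the center close to
  [psi_k] is killed by [1 - P].  A maximum of [m] sub-Gaussian variables costs
  [3 * delta * sqrt (ln (6 m) / n)].

The choice [delta = r `^ s] balances the two terms.  Projecting, rather than
replacing [psi_k] by its center, is what makes the first term small: a
combination of centers approximating [f] would only be known to have norm at
most [r + delta], whereas [|f P| <= |f| <= r].

The pointwise bound is [convex_combination_dot_le]; the two means are
[sign_mean_projector] and [sign_mean_bigmax_le]; they meet in
[sign_mean_conv_max_le].  All means are finite averages over sign vectors, to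
which [rademacher_expectation_le] reduces the expectation. *)

(** * Suprema and infima *)

(** Sets of natural numbers have a least element, so a bound on the covering
number yields an actual cover. *)
Lemma ereal_inf_natr_le {R : realType} {S : set nat} {r : R} :
  (ereal_inf [set (N%:R : R)%:E | N in S] <= r%:E)%E ->
  exists2 N, S N & (N%:R : R) <= r.
Proof.
move=> le_r.
have [N SN] : S !=set0.
  apply/set0P/negP => /eqP S0; move: le_r.
  by rewrite S0 image_set0 ereal_inf0.
have exS : exists k, `[< S k >] by exists N; apply/asboolP.
case: (ex_minnP exS) => k /asboolP Sk kmin; exists k => //.
rewrite -lee_fin (le_trans _ le_r)//.
apply: le_ereal_inf_tmp => _ [j Sj <-].
by rewrite lee_fin ler_nat kmin//; apply/asboolP.
Qed.

(** The bound [0 <= B] is there for the empty set, whose supremum is 0. *)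
Lemma norm_sup_le {R : realType} {S : set R} {B : R} :
  0 <= B -> (forall y, S y -> `|y| <= B) -> `|sup S| <= B.
Proof.
move=> B0 SB; have [->|/set0P [y Sy]] := eqVneq S set0.
  by rewrite sup0 normr0.
have Sub : ubound S B by move=> z /SB; apply: le_trans; exact: ler_norm.
rewrite ler_norml ge_sup ?andbT//; last by exists y.
apply: (le_trans (y := y)).
  by have := SB y Sy; rewrite ler_norml => /andP[].
by apply: ub_le_sup => //; exists B.
Qed.

(** * Averages over sign vectors *)

Definition rademacher_signs (R : realType) {n : nat} (b : {ffun 'I_n -> bool})
  : 'I_n -> R := fun i => (-1) ^+ b i.

Definition sign_mean {R : realType} {n : nat} (G : ('I_n -> R) -> R) : R :=
  2^-1 ^+ n * \sum_(b : {ffun 'I_n -> bool}) G (rademacher_signs R b).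

Lemma sign_mean_le {R : realType} {n : nat} (F G : ('I_n -> R) -> R) :
  (forall sg, F sg <= G sg) -> sign_mean F <= sign_mean G.
Proof.
move=> FG; rewrite /sign_mean ler_wpM2l ?exprn_ge0// ?invr_ge0//.
exact: ler_sum.
Qed.

Lemma sign_meanD {R : realType} {n : nat} (F G : ('I_n -> R) -> R) :
  sign_mean (fun sg => F sg + G sg) = sign_mean F + sign_mean G.
Proof. by rewrite /sign_mean big_split mulrDr. Qed.

Lemma sign_meanZ {R : realType} {n : nat} (c : R) (F : ('I_n -> R) -> R) :
  sign_mean (fun sg => c * F sg) = c * sign_mean F.
Proof. by rewrite /sign_mean -mulr_sumr mulrCA. Qed.

Lemma sign_mean_sum {R : realType} {n : nat} (I : finType)
    (F : I -> ('I_n -> R) -> R) :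
  sign_mean (fun sg => \sum_i F i sg) = \sum_i sign_mean (F i).
Proof. by rewrite /sign_mean exchange_big mulr_sumr. Qed.

(** Independence of the coordinates of a uniform sign vector, as the
distributivity of a product over sums. *)
Lemma sign_mean_prod {R : realType} {n : nat} (g : 'I_n -> R -> R) :
  sign_mean (fun sg => \prod_i g i (sg i)) =
  \prod_i ((g i 1 + g i (-1)) / 2).
Proof.
rewrite /sign_mean /rademacher_signs.
rewrite -(bigA_distr_bigA (fun i (c : bool) => g i ((-1) ^+ c))) /=.
rewrite -[X in _ ^+ X]card_ord -prodr_const -big_split /=.
apply: eq_bigr => i _.
by rewrite big_bool /= expr0 expr1 mulrC addrC.
Qed.

Lemma sign_mean_cst {R : realType} {n : nat} (c : R) :
  sign_mean (fun _ : 'I_n -> R => c) = c.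
Proof.
rewrite /sign_mean sumr_const card_ffun card_bool card_ord.
by rewrite -[c *+ _]mulr_natl natrX mulrA -exprMn mulVf ?expr1n ?mul1r.
Qed.

Lemma sign_mean_mul {R : realType} {n : nat} (i j : 'I_n) :
  sign_mean (fun sg : 'I_n -> R => sg i * sg j) = (i == j)%:R.
Proof.
have [<-|ij] := eqVneq i j.
  rewrite -[RHS](@sign_mean_cst R n 1); congr (_ * _).
  by apply: eq_bigr => b _; rewrite /rademacher_signs -expr2 sqrr_sign.
pose g (k : 'I_n) (y : R) := if (k == i) || (k == j) then y else 1.
have -> : (fun sg : 'I_n -> R => sg i * sg j) =
          (fun sg => \prod_k g k (sg k)).
  apply/funext => sg; rewrite (bigD1 i)//= (bigD1 j) 1?eq_sym//=.
  rewrite /g eqxx eqxx orbT /= big1 ?mulr1// => k /andP[/negPf ki /negPf kj].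
  by rewrite ki kj.
rewrite sign_mean_prod (bigD1 i)//= /g eqxx /=.
by rewrite subrr mul0r mul0r.
Qed.

(** * From the expectation to an average over signs *)

(** The integral of a nonnegative function is a supremum over the simple
functions below it, hence monotone without measurability.  This spares a proof
that the supremum [conv_max] is measurable. *)
Lemma ge0_le_integral_nonmeasurable {d} {T : measurableType d} {R : realType}
    (mu : {measure set T -> \bar R}) (f g : T -> \bar R) :
  (forall x, 0 <= f x)%E -> (forall x, f x <= g x)%E ->
  (\int[mu]_x f x <= \int[mu]_x g x)%E.
Proof.
move=> f0 fg; rewrite !ge0_integralTE//; last first.
  by move=> x; exact: le_trans (f0 x) (fg x).
apply: ereal_sup_le => _ [h hf <-]; exists h => // x.
exact: le_trans (hf x) (fg x).
Qed.

Lemma integral_restrict_cst {d} {T : measurableType d} {R : realType}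
    (P : probability T R) (A : set T) (r : \bar R) :
  measurable A -> (\int[P]_x (cst r \_ A) x = r * P A)%E.
Proof. by move=> mA; rewrite -integral_mkcond integral_cst. Qed.

(** The integrand is dominated by the sum of its values on the [2 ^ n] events
where the sequence equals a given sign vector, each of probability
[2^-1 ^+ n], and of [+oo] on the null events where a coordinate is not a
sign. *)
Lemma rademacher_expectation_le {R : realType} {n : nat} d
    (T : measurableType d) (P : probability T R) (eps : 'I_n -> {RV P >-> R})
    (H : ('I_n -> R) -> R) :
  rademacher_sequence eps -> (forall sg, 0 <= H sg) ->
  ('E_P[fun w => H (fun i => eps i w)] <= (sign_mean H)%:E)%E.
Proof.
move=> [indep half] H0.
have mpre i (c : R) : measurable (eps i @^-1` [set c]).
  by rewrite -[_ @^-1` _]setTI; exact: measurable_funP.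
pose A (b : {ffun 'I_n -> bool}) : set T :=
  \bigcap_(i in [set i | i \in [set: 'I_n]%SET])
    (eps i @^-1` [set rademacher_signs R b i]).
have mA b : measurable (A b).
  apply: fin_bigcap_measurable => // i _; exact: mpre.
have PA b : P (A b) = (2^-1 ^+ n)%:E.
  rewrite /A (indep _ (fun i => [set rademacher_signs R b i])); last first.
    by move=> i; exact: measurable_set1.
  rewrite (eq_bigr (fun=> (2^-1 : R)%:E)) => [|i _]; last first.
    rewrite /rademacher_signs; case: (b i); rewrite ?expr1 ?expr0.
      exact: (half i).2.
    exact: (half i).1.
  by rewrite prodEFin prodr_const cardsT card_ord.
pose N i := ~` (eps i @^-1` [set 1] `|` eps i @^-1` [set -1]).
have mN i : measurable (N i) by apply: measurableC; exact: measurableU.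
have PN i : P (N i) = 0%E.
  have disj : (eps i @^-1` [set 1]) `&` (eps i @^-1` [set -1]) = set0.
    apply/seteqP; split => // w [/= ->] /eqP.
    by rewrite -subr_eq0 opprK -[1 + 1]/(1 *+ 2) pnatr_eq0.
  have PU : P (eps i @^-1` [set 1] `|` eps i @^-1` [set -1]) = 1%E.
    rewrite measureU//.
    transitivity ((2^-1 : R)%:E + (2^-1 : R)%:E)%E; last first.
      by rewrite -EFinD; congr EFin; lra.
    by congr (_ + _)%E; [exact: (half i).1|exact: (half i).2].
  by rewrite probability_setC ?PU ?subee//; exact: measurableU.
pose f (k : {ffun 'I_n -> bool} + 'I_n) : T -> \bar R :=
  match k with
  | inl b => cst (H (rademacher_signs R b))%:E \_ (A b)
  | inr i => cst +oo%E \_ (N i)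
  end.
have f0 k x : (0 <= f k x)%E.
  by case: k => [b|i]; rewrite /f /patch /=; case: ifP => // _; rewrite lee_fin.
rewrite unlock.
apply: (le_trans (y := (\int[P]_w \sum_k f k w)%E)).
  apply: ge0_le_integral_nonmeasurable => w; first by rewrite lee_fin.
  have single k : (f k w <= \sum_j f j w)%E.
    rewrite (bigD1 k)//= leeDl// sume_ge0//.
  have [[i Ni]|all_sign] := pselect (exists i, N i w).
    apply: le_trans (single (inr i)).
    by rewrite /= /patch mem_set// leey.
  pose b := [ffun i => eps i w == -1].
  have epsE : (fun i => eps i w) = rademacher_signs R b.
    apply/funext => i; rewrite /rademacher_signs ffunE.
    have : ~ N i w by move=> Ni; apply: all_sign; exists i.
    move=> /contrapT [/= ->|/= ->]; last by rewrite eqxx.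
    by case: eqP => // /eqP;
      rewrite -subr_eq0 opprK -[1 + 1]/(1 *+ 2) pnatr_eq0.
  apply: le_trans (single (inl b)).
  rewrite /= /patch mem_set ?epsE// => i _ /=.
  by rewrite -epsE.
rewrite ge0_integral_sum//; last first.
  by move=> [b|i]; apply/(measurable_restrictT _ _).1.
rewrite big_sumType /= [X in (_ + X)%E]big1 ?adde0; last first.
  by move=> i _; rewrite integral_restrict_cst// PN mule0.
rewrite (eq_bigr (fun b => (2^-1 ^+ n * H (rademacher_signs R b))%:E)).
  by rewrite sumEFin -mulr_sumr.
by move=> b _; rewrite integral_restrict_cst// PA mulrC.
Qed.

(** * Sub-Gaussian maxima *)

(** The sharp constant is 1/2.  The constant 2 only needs [1 + x <= expR x]:
by symmetry let [0 <= x]; when [x <= 1/2] one inverts [1 - x <= expR (- x)] to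
get [expR x <= 1 + x + 2 * x ^+ 2], and when [1/2 < x] the left side is at
most [expR x], which is below the bound because [x <= 2 * x ^+ 2]. *)
Lemma cosh_le_expR {R : realType} (x : R) :
  (expR x + expR (- x)) / 2 <= expR (2 * x ^+ 2).
Proof.
wlog x0 : x / 0 <= x => [wlg|].
  have [/wlg//|/ltW x0] := leP 0 x.
  have := wlg (- x); rewrite opprK sqrrN oppr_ge0 addrC; exact.
have [x_small|x_big] := leP x 2^-1; last first.
  apply: (le_trans (y := expR x)).
    have : expR (- x) <= expR x by rewrite ler_expR; lra.
    lra.
  by rewrite ler_expR; nra.
(* Each exponential is bounded from above through a lower bound on the other,
   their product being 1. *)
have upper : expR x <= 1 + x + 2 * x ^+ 2.
  have inv : expR x * expR (- x) = 1 by rewrite expRN divff// gt_eqF// expR_gt0.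
  have := expR_ge1Dx (- x); have := expR_gt0 x; nra.
have lower : expR (- x) <= 1 - x + x ^+ 2.
  have inv : expR x * expR (- x) = 1 by rewrite expRN divff// gt_eqF// expR_gt0.
  have := expR_ge1Dx x; have := expR_gt0 (- x); nra.
apply: le_trans (expR_ge1Dx _); nra.
Qed.

Lemma sign_mean_expR {R : realType} {n : nat} (a : 'I_n -> R) :
  sign_mean (fun sg => expR (\sum_i a i * sg i)) <=
  expR (2 * \sum_i a i ^+ 2).
Proof.
rewrite (_ : (fun sg => _) = (fun sg => \prod_i expR (a i * sg i))); last first.
  by apply/funext => sg; rewrite expR_sum.
rewrite (sign_mean_prod (fun i y => expR (a i * y))) mulr_sumr expR_sum.
apply: ler_prod => i _; rewrite mulr1 mulrN1 cosh_le_expR andbT.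
by rewrite divr_ge0// addr_ge0// expR_ge0.
Qed.

(** The exponential moment method, with Jensen's inequality for the logarithm
replaced by its tangent [y <= ln K - 1 + expR y / K].  With [lam] the
exponent parameter, the exponential moment of the maximum is at most
[2 * m * expR (2 * lam ^+ 2 * r ^+ 2)]; taking [lam = sqrt L / r] makes it at
most [K = expR (3 * L)], whence the bound [3 * L / lam]. *)
Lemma sign_mean_bigmax_le {R : realType} {n m : nat} (a : 'I_m -> 'I_n -> R)
    (r L : R) :
  0 < r -> 0 < L -> ln (2 * m%:R) <= L ->
  (forall k, \sum_i a k i ^+ 2 <= r ^+ 2) ->
  sign_mean (fun sg => \big[Num.max/0]_k `|\sum_i a k i * sg i|) <=
  3 * r * Num.sqrt L.
Proof.
move=> r0 L0; case: m a => [|m] a mL ar.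
  rewrite (_ : (fun sg => _) = (fun=> 0)); last first.
    by apply/funext => sg; rewrite big_ord0.
  by rewrite sign_mean_cst !mulr_ge0 ?sqrtr_ge0 ?ltW.
have sL0 : 0 < Num.sqrt L by rewrite sqrtr_gt0.
have sLL : Num.sqrt L ^+ 2 = L by rewrite sqr_sqrtr ?ltW.
have rl : r != 0 by rewrite gt_eqF.
pose lam := Num.sqrt L / r.
have lam0 : 0 < lam by rewrite divr_gt0.
pose Z sg := \sum_k (expR (\sum_i (lam * a k i) * sg i) +
                     expR (\sum_i (- lam * a k i) * sg i)).
pose K := expR (3 * L).
have EZ : sign_mean Z <= K.
  rewrite /Z sign_mean_sum.
  apply: (le_trans (y := \sum_(k < m.+1) 2 * expR (2 * L))).
    apply: ler_sum => k _; rewrite sign_meanD.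
    have bnd (c : R) : c ^+ 2 = lam ^+ 2 ->
        sign_mean (fun sg => expR (\sum_i (c * a k i) * sg i)) <= expR (2 * L).
      move=> c2; apply: le_trans (sign_mean_expR _) _.
      rewrite ler_expR ler_pM2l//.
      rewrite (eq_bigr (fun i => lam ^+ 2 * a k i ^+ 2)) => [|i _]; last first.
        by rewrite exprMn c2.
      rewrite -mulr_sumr -sLL (_ : Num.sqrt L ^+ 2 = lam ^+ 2 * r ^+ 2).
        by rewrite ler_wpM2l ?sqr_ge0.
      by rewrite /lam -exprMn divfK.
    by rewrite mulrDl !mul1r lerD// bnd// sqrrN.
  rewrite sumr_const card_ord -[_ *+ m.+1]mulr_natl mulrA.
  rewrite /K (_ : 3 * L = L + 2 * L); last by ring.
  rewrite expRD ler_wpM2r ?expR_ge0// [_ * 2]mulrC.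
  by rewrite -[leLHS]lnK ?ler_expR// posrE mulr_gt0 ?ltr0n.
have K0 : 0 < K by exact: expR_gt0.
have <- : lam^-1 * (3 * L) = 3 * r * Num.sqrt L.
  by rewrite -{1}sLL /lam invf_div expr2; field; rewrite gt_eqF.
apply: (le_trans (y := sign_mean (fun sg =>
    lam^-1 * (3 * L - 1 + K^-1 * Z sg)))).
  apply: sign_mean_le => sg.
  have expge y : y <= 3 * L - 1 + K^-1 * expR y.
    have := expR_ge1Dx (y - 3 * L).
    by rewrite expRD expRN -/K mulrC; lra.
  suff le_k k : `|\sum_i a k i * sg i| <= lam^-1 * (3 * L - 1 + K^-1 * Z sg).
    by apply: bigmax_le => [|k _]; [exact: le_trans (le_k ord0)|exact: le_k].
  rewrite ler_pdivlMl//.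
  have Zk : expR (\sum_i (lam * a k i) * sg i) +
            expR (\sum_i (- lam * a k i) * sg i) <= Z sg.
    rewrite /Z (bigD1 k)//= lerDl; apply: sumr_ge0 => j _.
    by rewrite addr_ge0 ?expR_ge0.
  have lin c : \sum_i (c * a k i) * sg i = c * \sum_i a k i * sg i.
    by rewrite mulr_sumr; apply: eq_bigr => i _; rewrite mulrA.
  move: Zk; rewrite !lin => Zk.
  rewrite -[X in X * _](gtr0_norm lam0) -normrM.
  set y := lam * _ in Zk *; rewrite mulNr -/y in Zk.
  apply: le_trans (expge _) _; rewrite lerD2l ler_wpM2l ?invr_ge0 ?(ltW K0)//.
  apply: le_trans Zk.
  have := expR_ge0 y; have := expR_ge0 (- y).
  by case: (ger0P y) => _; lra.
rewrite sign_meanZ sign_meanD sign_mean_cst sign_meanZ.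
rewrite ler_wpM2l ?invr_ge0 ?(ltW lam0)//.
have : K^-1 * sign_mean Z <= 1 by rewrite ler_pdivrMl// mulr1.
lra.
Qed.
(** * Orthogonal projectors *)

Definition sqnorm {R : realType} {n : nat} (u : 'rV[R]_n) : R :=
  \sum_i u 0 i ^+ 2.

Lemma sqnormE {R : realType} {n : nat} (u : 'rV[R]_n) :
  u *m u^T = (sqnorm u)%:M.
Proof.
rewrite [LHS]mx11_scalar mxE; congr (_%:M).
by apply: eq_bigr => i _; rewrite mxE expr2.
Qed.

Lemma sqnorm_ge0 {R : realType} {n : nat} (u : 'rV[R]_n) : 0 <= sqnorm u.
Proof. by apply: sumr_ge0 => i _; exact: sqr_ge0. Qed.

Lemma sqnorm_eq0 {R : realType} {n : nat} (u : 'rV[R]_n) :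
  sqnorm u = 0 -> u = 0.
Proof.
move=> /eqP; rewrite psumr_eq0 => [|i _]; last exact: sqr_ge0.
move=> /allP u0; apply/rowP => i; rewrite mxE; apply/eqP.
by rewrite -sqrf_eq0; apply: u0; rewrite mem_index_enum.
Qed.

Definition orthogonal_projector {R : realType} {n : nat} (P : 'M[R]_n) :=
  P^T = P /\ P *m P = P.

(** Gram-Schmidt: each vector adds to the projector the rank-one projector onto
its component [u] orthogonal to the previous ones, of trace 1.  The trace bounds
the dimension of the range. *)
Lemma orthogonal_projector_exists {R : realType} {n N : nat}
    (c : 'I_N -> 'rV[R]_n) :
  exists P, [/\ orthogonal_projector P, \tr P <= N%:R
    & forall j, c j *m P = c j].
Proof.
elim: N c => [|N IH] c.
  exists 0; split; [by split; rewrite ?trmx0 ?mulmx0|by rewrite mxtrace0|].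
  by case.
have [P [[Psym Pidem] trP cP]] := IH (fun j => c (lift ord0 j)).
pose u := c ord0 - c ord0 *m P.
have uP : u *m P = 0 by rewrite mulmxBl -mulmxA Pidem subrr.
have Pu : P *m u^T = 0 by rewrite -[P]Psym -trmx_mul uP trmx0.
have c0E : c ord0 = c ord0 *m P + u by rewrite addrC subrK.
clearbody u.
have [u0|q0] := eqVneq (sqnorm u) 0.
  exists P; split=> //; first by rewrite (le_trans trP)// ler_nat.
  move=> j; case: (unliftP ord0 j) => [k ->|->]; first exact: cP.
  by rewrite [RHS]c0E (sqnorm_eq0 _ u0) addr0.
exists (P + (sqnorm u)^-1 *: (u^T *m u)); split.
- split; first by rewrite linearD linearZ /= trmx_mul trmxK Psym.
  rewrite mulmxDl !mulmxDr Pidem -!scalemxAr -!scalemxAl !mulmxA Pu.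
  rewrite -[_ *m u *m P]mulmxA uP mulmx0 mul0mx !scaler0 addr0 add0r.
  rewrite -[u^T *m u *m u^T]mulmxA sqnormE mul_mx_scalar -scalemxAl.
  by rewrite (scalerA _ (sqnorm u)) mulVf// scale1r.
- rewrite mxtraceD mxtraceZ mxtrace_mulC sqnormE mxtrace_scalar mulr1n.
  by rewrite mulVf// -natr1 lerD2r.
- move=> j; rewrite mulmxDr -scalemxAr mulmxA.
  case: (unliftP ord0 j) => [k ->|->].
    by rewrite cP -{2}[c _]cP -[_ *m P *m _]mulmxA Pu mulmx0 mul0mx
      scaler0 addr0.
  rewrite {2}c0E mulmxDl -[_ *m P *m u^T]mulmxA Pu mulmx0 add0r sqnormE.
  by rewrite mul_scalar_mx scalerA mulVf// scale1r -c0E.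
Qed.

Lemma sqnorm_projector {R : realType} {n : nat} (P : 'M[R]_n) (u : 'rV[R]_n) :
  orthogonal_projector P -> (sqnorm (u *m P))%:M = u *m P *m u^T.
Proof.
move=> [Psym Pidem].
by rewrite -sqnormE trmx_mul Psym mulmxA -[_ *m P *m P]mulmxA Pidem.
Qed.

Lemma orthogonal_projectorC {R : realType} {n : nat} (P : 'M[R]_n) :
  orthogonal_projector P -> orthogonal_projector (1%:M - P).
Proof.
move=> [Psym Pidem]; split; first by rewrite linearB /= trmx1 Psym.
by rewrite mulmxBl mul1mx mulmxBr mulmx1 Pidem subrr subr0.
Qed.

(** Pythagoras: [|u|^2 = |u P|^2 + |u (1 - P)|^2]. *)
Lemma sqnorm_projector_le {R : realType} {n : nat} (P : 'M[R]_n)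
    (u : 'rV[R]_n) :
  orthogonal_projector P -> sqnorm (u *m P) <= sqnorm u.
Proof.
move=> projP.
have : (sqnorm u)%:M =
    (sqnorm (u *m P) + sqnorm (u *m (1%:M - P)))%:M :> 'M[R]_(1, 1).
  rewrite raddfD /= !sqnorm_projector//; last exact: orthogonal_projectorC.
  by rewrite -sqnormE -mulmxDl -mulmxDr addrC subrK mulmx1.
move=> /matrixP /(_ 0 0); rewrite !mxE /= !mulr1n => ->.
by rewrite lerDl sqnorm_ge0.
Qed.

(** Distinct signs are uncorrelated, so only the diagonal of [P] survives in the
mean of the quadratic form [sg P sg^T]. *)
Lemma sign_mean_projector {R : realType} {n : nat} (P : 'M[R]_n) :
  orthogonal_projector P ->
  sign_mean (fun sg => sqnorm ((\row_i sg i) *m P)) = \tr P.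
Proof.
move=> projP.
have -> : (fun sg : 'I_n -> R => sqnorm ((\row_i sg i) *m P)) =
          (fun sg => \sum_i \sum_j P j i * (sg j * sg i)).
  apply/funext => sg.
  have /matrixP/(_ 0 0) := sqnorm_projector P (\row_i sg i) projP.
  rewrite !mxE /= mulr1n => ->; apply: eq_bigr => i _.
  rewrite !mxE mulr_suml; apply: eq_bigr => j _.
  by rewrite !mxE; ring.
rewrite sign_mean_sum; apply: eq_bigr => i _.
rewrite sign_mean_sum (bigD1 i)//= sign_meanZ sign_mean_mul eqxx mulr1.
rewrite big1 ?addr0// => j /negPf ji.
by rewrite sign_meanZ sign_mean_mul ji mulr0.
Qed.

(** Cauchy-Schwarz in its additive form: the bound is affine in the squared
norms, so that averaging over signs needs no Jensen inequality for the square
root. *)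
Lemma dot_le_sqnorm {R : realType} {n : nat} (u v : 'rV[R]_n) (c : R) :
  0 < c ->
  `|\sum_i u 0 i * v 0 i| <= (c * sqnorm u + c^-1 * sqnorm v) / 2.
Proof.
move=> c0; apply: le_trans (ler_norm_sum _ _ _) _.
rewrite /sqnorm !mulr_sumr -big_split /= mulr_suml; apply: ler_sum => i _.
set y := u 0 i; set z := v 0 i.
have sq w : c * y ^+ 2 + c^-1 * z ^+ 2 + 2 * w * (y * z) =
    c^-1 * (c * y + w * z) ^+ 2 + c^-1 * (1 - w ^+ 2) * z ^+ 2.
  by field; rewrite gt_eqF.
have := sq 1; have := sq (-1); rewrite sqrrN expr1n subrr mulr0 mul0r !addr0.
have i0 : 0 <= c^-1 by rewrite invr_ge0 ltW.
have := mulr_ge0 i0 (sqr_ge0 (c * y + 1 * z)).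
have := mulr_ge0 i0 (sqr_ge0 (c * y + -1 * z)).
by case: (ger0P (y * z)) => _; lra.
Qed.

(** The decomposition at the heart of the proof.  As [P] is symmetric,
[f P] pairs with [sg] as [f] pairs with [sg P], and only the fixed vector
[sg P] remains to be averaged; a convex combination of the residuals pairs with
[sg] no better than the best of them. *)
Lemma convex_combination_dot_le {R : realType} {n m : nat}
    (v : 'I_m -> 'rV[R]_n) (theta : 'I_m -> R) (P : 'M[R]_n)
    (sg : 'I_n -> R) (c q : R) :
  (forall k, 0 <= theta k) -> \sum_k theta k = 1 -> orthogonal_projector P ->
  0 < c -> sqnorm (\sum_k theta k *: v k) <= q ->
  `|\sum_i (\sum_k theta k *: v k) 0 i * sg i| <=
  (c * q + c^-1 * sqnorm ((\row_i sg i) *m P)) / 2 +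
  \big[Num.max/0]_k `|\sum_i (v k *m (1%:M - P)) 0 i * sg i|.
Proof.
move=> theta0 theta1 projP c0; set f := \sum_k _ => fq.
set s := \row_i sg i.
have dotE (g : 'rV[R]_n) : \sum_i g 0 i * sg i = (g *m s^T) 0 0.
  by rewrite mxE; apply: eq_bigr => i _; rewrite !mxE.
have split_f : \sum_i f 0 i * sg i =
    \sum_i f 0 i * (s *m P) 0 i +
    \sum_k theta k * \sum_i (v k *m (1%:M - P)) 0 i * sg i.
  rewrite (eq_bigr (fun k => theta k * (v k *m (1%:M - P) *m s^T) 0 0)).
    rewrite dotE (_ : \sum_i _ = (f *m P *m s^T) 0 0); last first.
      rewrite -mulmxA -[P in RHS]projP.1 -trmx_mul [RHS]mxE.
      by apply: eq_bigr => i _; rewrite [in RHS]mxE.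
    rewrite (_ : \sum_k _ = (f *m (1%:M - P) *m s^T) 0 0); last first.
      rewrite /f !mulmx_suml summxE; apply: eq_bigr => k _.
      by rewrite -!scalemxAl [RHS]mxE.
    have -> : f *m s^T = f *m P *m s^T + f *m (1%:M - P) *m s^T.
      by rewrite -mulmxDl -mulmxDr addrC subrK mulmx1.
    by rewrite mxE.
  by move=> k _; rewrite dotE.
rewrite split_f; apply: le_trans (ler_normD _ _) _; apply: lerD.
  apply: le_trans (dot_le_sqnorm f (s *m P) c c0) _.
  by rewrite ler_pM2r// lerD2r ler_pM2l.
apply: le_trans (ler_norm_sum _ _ _) _.
set M := (X in _ <= X).
apply: (le_trans (y := \sum_k theta k * M)); last first.
  by rewrite -mulr_suml theta1 mul1r.
apply: ler_sum => k _; rewrite normrM ger0_norm// ler_wpM2l//.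
by rewrite /M (bigD1 k)//= le_max lexx.
Qed.

(** * The localized convex hull *)

Definition design_row {R : realType} {X : Type} {n : nat} (x : 'I_n -> X)
  (f : X -> R) : 'rV[R]_n := \row_i f (x i).

Lemma norm_n_le {R : realType} {X : Type} {n : nat} (x : 'I_n -> X)
    (f : X -> R) (r : R) : (0 < n)%N -> 0 <= r ->
  (norm_n x f <= r) = (sqnorm (design_row x f) <= (r * Num.sqrt n%:R) ^+ 2).
Proof.
move=> n0 r0; have n0' : 0 < n%:R :> R by rewrite ltr0n.
have -> : sqnorm (design_row x f) = \sum_(i < n) f (x i) ^+ 2.
  by apply: eq_bigr => i _; rewrite mxE.
rewrite /norm_n -[r in LHS](ger0_norm r0) -sqrtr_sqr ler_sqrt ?sqr_ge0//.
by rewrite ler_pdivrMl// exprMn sqr_sqrtr ?(ltW n0')// [in RHS]mulrC.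
Qed.

Lemma conv_hull_norm_n_le1 {R : realType} {X : Type} {n m : nat}
    (x : 'I_n -> X) (psi : 'I_m -> X -> R) (f : X -> R) :
  (0 < n)%N -> (forall k, norm_inf x (psi k) <= 1) -> conv_hull psi f ->
  norm_n x f <= 1.
Proof.
move=> n0 psi1 [theta [theta0 theta1 ->]].
rewrite norm_n_le// mul1r sqr_sqrtr ?ler0n//.
apply: (le_trans (y := \sum_(i < n) 1)); last by rewrite sumr_const card_ord.
apply: ler_sum => i _; rewrite mxE -real_normK ?num_real// expr_le1//.
apply: le_trans (ler_norm_sum _ _ _) _.
rewrite -theta1; apply: ler_sum => k _.
rewrite normrM ger0_norm// ler_piMr//; apply: le_trans (psi1 k).
by rewrite /norm_inf (bigD1 i)//= le_max lexx.
Qed.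

Lemma conv_max_min1 {R : realType} {X : Type} {n m : nat}
    (x : 'I_n -> X) (psi : 'I_m -> X -> R) (e : R) :
  (0 < n)%N -> (forall k, norm_inf x (psi k) <= 1) ->
  conv_max x psi e = conv_max x psi (Num.min e 1).
Proof.
move=> n0 psi1; apply/funext => sg; rewrite /conv_max; congr sup.
apply/seteqP; split => _ [f [hull_f fe] <-]; exists f => //; split => //.
  by rewrite le_min fe (conv_hull_norm_n_le1 x psi f).
by move: fe; rewrite le_min => /andP[].
Qed.

(** The bound for an arbitrary cover, with [t] an upper bound for the square
root of its cardinality. *)
Lemma sign_mean_conv_max_le {R : realType} {X : Type} {n m N : nat}
    (x : 'I_n -> X) (psi : 'I_m -> X -> R) (c : 'I_N -> X -> R)
    (r delta t L : R) :
  (0 < n)%N -> 0 < r -> 0 < delta -> 0 < t -> 0 < L ->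
  range psi `<=` \bigcup_j closed_ball_n x (c j) delta ->
  N%:R <= t ^+ 2 -> ln (2 * m%:R) <= L ->
  sign_mean (fun sg => `|conv_max x psi r sg|) <=
  (r * t + 3 * delta * Num.sqrt L) / Num.sqrt n%:R.
Proof.
move=> n0 r0 d0 t0 L0 cover Nt mL.
have n0' : 0 < n%:R :> R by rewrite ltr0n.
set w : R := Num.sqrt n%:R.
have w0 : 0 < w by rewrite sqrtr_gt0.
have ww : n%:R = w ^+ 2 by rewrite sqr_sqrtr ?ltW.
have [P [projP trP cP]] :=
  orthogonal_projector_exists (fun j => design_row x (c j)).
pose v k := design_row x (psi k).
(* Replacing [psi k] by its difference with a center leaves its image under
   [1 - P] unchanged. *)
have residual k : \sum_i (v k *m (1%:M - P)) 0 i ^+ 2 <= (delta * w) ^+ 2.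
  have [j _ ] : (\bigcup_j closed_ball_n x (c j) delta) (psi k).
    by apply: cover; exists k.
  rewrite /closed_ball_n /= norm_n_le ?(ltW d0)//; apply: le_trans.
  rewrite -/(sqnorm _).
  have -> : v k *m (1%:M - P) =
            design_row x (psi k \- c j) *m (1%:M - P).
    have -> : design_row x (psi k \- c j) = v k - design_row x (c j).
      by apply/rowP => i; rewrite !mxE.
    by rewrite [RHS]mulmxBl [design_row x (c j) *m _]mulmxBr mulmx1 cP
       subrr subr0.
  exact/sqnorm_projector_le/orthogonal_projectorC.
(* This weight balances [al * (r * w) ^+ 2] against [al^-1 * t ^+ 2], the
   upper bounds for the two terms of [dot_le_sqnorm]. *)
pose al := t / (r * w).
have rw0 : 0 < r * w by exact: mulr_gt0.
have al0 : 0 < al by exact: divr_gt0.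
pose M (sg : 'I_n -> R) :=
  \big[Num.max/0]_k `|\sum_i (v k *m (1%:M - P)) 0 i * sg i|.
pose B (sg : 'I_n -> R) := n%:R^-1 *
  (2^-1 * (al * (r * w) ^+ 2 + al^-1 * sqnorm ((\row_i sg i) *m P)) + M sg).
have bound sg : `|conv_max x psi r sg| <= B sg.
  apply: norm_sup_le.
    rewrite /B mulr_ge0 ?invr_ge0 ?ler0n// addr_ge0//.
      rewrite mulr_ge0// addr_ge0// mulr_ge0 ?sqr_ge0 ?sqnorm_ge0 ?invr_ge0//.
        exact: ltW.
      exact: ltW.
    by rewrite /M; elim/big_ind : _ => // y z y0 z0; rewrite le_max y0.
  move=> _ [f [[theta [theta0 theta1 fE]] fr] <-].
  rewrite normrM ger0_norm ?invr_ge0 ?ler0n// ler_wpM2l ?invr_ge0 ?ler0n//.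
  have fvE : design_row x f = \sum_k theta k *: v k.
    apply/rowP => i; rewrite fE mxE summxE; apply: eq_bigr => k _.
    by rewrite !mxE.
  rewrite (eq_bigr (fun i => (\sum_k theta k *: v k) 0 i * sg i)) => [|i _].
    rewrite [2^-1 * _]mulrC; apply: convex_combination_dot_le => //.
    by rewrite -fvE -norm_n_le// ltW.
  by rewrite -fvE mxE.
apply: le_trans (sign_mean_le _ _ bound) _.
rewrite sign_meanZ sign_meanD sign_meanZ sign_meanD sign_mean_cst.
rewrite sign_meanZ sign_mean_projector//.
have le_M : sign_mean M <= 3 * (delta * w) * Num.sqrt L.
  exact: (sign_mean_bigmax_le (fun k i => (v k *m (1%:M - P)) 0 i)
            _ _ (mulr_gt0 d0 w0) L0 mL residual).
apply: (le_trans (y := n%:R^-1 *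
    (2^-1 * (al * (r * w) ^+ 2 + al^-1 * t ^+ 2) +
     3 * (delta * w) * Num.sqrt L))).
  rewrite ler_wpM2l ?invr_ge0 ?ler0n// lerD// ler_wpM2l// lerD2l.
  by rewrite ler_wpM2l ?invr_ge0 ?(ltW al0)// (le_trans trP).
rewrite ww /al le_eqVlt; apply/orP; left; apply/eqP; field.
by rewrite !gt_eqF.
Qed.

Lemma ln_mul_ge1 {R : realType} {m : nat} :
  (1 <= m)%N -> 1 <= ln (6 * m%:R : R).
Proof.
move=> m1; have m1' : 1 <= m%:R :> R by rewrite ler1n.
rewrite -[leLHS]expRK ler_ln ?posrE ?expR_gt0//; last by lra.
have half : expR (2^-1 : R) <= 2.
  have := expR_ge1Dx (- 2^-1 : R); rewrite expRN => half.
  have : expR (2^-1 : R) * (expR (2^-1 : R))^-1 = 1.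
    by rewrite divff// gt_eqF// expR_gt0.
  have := expR_gt0 (2^-1 : R); nra.
have -> : (1 : R) = 2^-1 + 2^-1 by lra.
by rewrite expRD; have := expR_gt0 (2^-1 : R); nra.
Qed.

Theorem theorem2p1 (R : realType) (X : Type) (n m : nat) (hn : (0 < n)%N)
    (x : 'I_n -> X) (psi : 'I_m -> X -> R)
    (assumptionA : forall k, norm_inf x (psi k) <= 1)
    (A s : R) (hA : 1 <= A) (hs0 : 0 < s) (hs1 : s <= 1)
    (V : R) (hV : V = 2 / s - 2)
    (assumptionB : forall e : R, 0 < e -> e <= 1 ->
       (covering_number x e (range psi) <= (A * e `^ (- V))%:E)%E)
    (d : measure_display) (T : measurableType d) (P : probability T R)
    (eps : 'I_n -> {RV P >-> R}) (heps : rademacher_sequence eps)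
    (hm : (4 <= m)%N) (e : R) (he : 16 / m%:R <= e) :
  ('E_P[fun w => `|conv_max x psi e (fun i => eps i w)|%R] <=
   (20 * Num.sqrt (1 + 2 * A) * e `^ s *
      Num.sqrt (ln (6 * m%:R) / n%:R))%:E)%E.
Proof.
have n0 : 0 < n%:R :> R by rewrite ltr0n.
have m0 : 0 < m%:R :> R by rewrite ltr0n (leq_trans _ hm).
have e0 : 0 < e by apply: lt_le_trans he; rewrite divr_gt0.
rewrite conv_max_min1//; set r := Num.min e 1.
have r0 : 0 < r by rewrite lt_min e0 ltr01.
have r1 : r <= 1 by rewrite ge_min lexx orbT.
set L : R := ln (6 * m%:R).
have L1 : 1 <= L by apply: ln_mul_ge1; exact: leq_trans hm.
have L0 : 0 < L by lra.
have mL : ln (2 * m%:R) <= L.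
  by rewrite ler_ln ?posrE ?mulr_gt0// ler_pM2r// ler_nat.
set delta := r `^ s.
have d0 : 0 < delta by exact: powR_gt0.
have d1 : delta <= 1.
  have -> : 1 = 1 `^ s :> R by rewrite powR1.
  by rewrite ge0_ler_powR ?nnegrE ?ler01// ltW.
pose t := Num.sqrt A * r `^ (s - 1).
have t0 : 0 < t.
  by rewrite mulr_gt0 ?powR_gt0// sqrtr_gt0 (lt_le_trans ltr01).
(* Here [V * s = 2 - 2 * s] makes the covering bound at scale [delta] equal to
   [A * r `^ (2 * s - 2)]. *)
have tE : A * delta `^ (- V) = t ^+ 2.
  rewrite exprMn sqr_sqrtr ?(le_trans ler01)//; congr (_ * _).
  rewrite -powRrM -[RHS]powR_mulrn ?powR_ge0// -powRrM; congr powR.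
  by rewrite hV; field; rewrite gt_eqF.
have [N [c cover] Nt] := ereal_inf_natr_le (assumptionB _ d0 d1).
rewrite tE in Nt.
apply: le_trans (rademacher_expectation_le _ _ _ _
  (fun sg => `|conv_max x psi r sg|) heps _) _.
  by move=> sg; exact: normr_ge0.
rewrite lee_fin.
apply: le_trans (sign_mean_conv_max_le x psi c r delta t L
  hn r0 d0 t0 L0 cover Nt mL) _.
have rtE : r * t = Num.sqrt A * delta.
  by rewrite /t mulrCA mulr_powRB1// ltW.
rewrite rtE sqrtrM ?(ltW L0)// sqrtrV ?ler0n// !mulrA ler_wpM2r//.
have delta_le : delta <= e `^ s.
  by rewrite ge0_ler_powR ?nnegrE ?ge_min ?lexx// ltW.
set a := Num.sqrt A; set b := Num.sqrt (1 + 2 * A); set l := Num.sqrt L.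
have ab : a <= b by rewrite ler_wsqrtr//; lra.
have b1 : 1 <= b by rewrite -sqrtr1 ler_wsqrtr//; lra.
have l1 : 1 <= l by rewrite -sqrtr1 ler_wsqrtr.
apply: (le_trans (y := 20 * b * delta * l)); last first.
  by rewrite ler_wpM2r ?sqrtr_ge0// ler_wpM2l// mulr_ge0// (le_trans ler01).
have -> : a * delta + 3 * delta * l = (a + 3 * l) * delta by ring.
have -> : 20 * b * delta * l = (20 * (b * l)) * delta by ring.
rewrite ler_pM2r//.
have bl_b : b <= b * l by rewrite ler_peMr// (le_trans ler01).
have bl_l : l <= b * l by rewrite ler_peMl// (le_trans ler01).
lra.
Qed.
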